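(* Let $n\ge 1$ and let $\mathcal{A}_n$ be the ASM poset. For $1\le i\le n-1$ let $\mathrm{pro}_i$ be the permutation of $J(\mathcal{A}_n)$ obtained by applying, for $t=3,4,\dots,2i+1$ in increasing order, the product of the toggles $t_p$ over all elements $p=(i;a,b)$ of layer $i$ with $a+b=t$. Define superpromotion $\mathrm{spro}=\mathrm{pro}_1\circ\mathrm{pro}_2\circ\cdots\circ\mathrm{pro}_{n-1}$ (so $\mathrm{pro}_{n-1}$ is applied first). Then the order of $\mathrm{spro}$ as a permutation of $J(\mathcal{A}_n)$ is divisible by $3n-2$.
   Context: The ASM poset $\mathcal{A}_n$ has elements $(i;a,b)$ with $1\le i\le n-1$ and $1\le a<b\le i+1$ (layer $i$ is a copy of $\Phi^+(A_i)$, $(i;a,b)$ corresponding to $e_a-e_b$). Its order is the reflexive-transitive closure of: within layer $i$, $(i;a,b)$ covers $(i;a+1,b)$ and $(i;a,b-1)$ whenever $b-a\ge 2$; between layers, $(i;a,b)$ covers $(i+1;a,b)$ and $(i+1;a+1,b+1)$. $J(\mathcal{A}_n)$ is its set of order ideals. Toggle $t_p$ on $J(\mathcal{A}_n)$ (with respect to the whole poset $\mathcal{A}_n$): $t_p(I)=I\cup\{p\}$ if $p\notin I$ and all $p'<p$ lie in $I$; $t_p(I)=I\setminus\{p\}$ if $p\in I$ and no $p'>p$ lies in $I$; $t_p(I)=I$ otherwise.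
   Formalization: The case n = 2 is excluded: there the ASM poset has one element, J has two elements, and spro is a single toggle of order 2, which is not divisible by 3n−2 = 4. *)

(* Defs.v *)
From HB Require Import structures.
From mathcomp Require Import all_boot all_order all_fingroup cyclic.

Set Implicit Arguments.
Unset Strict Implicit.
Unset Printing Implicit Defensive.

Import Order.TTheory.

(* All indices are 1-based: (i;a,b) is stored as the triple of naturals i, a, b
   itself, so the value 0 of each ordinal type is never used. *)
Definition asm_elt n : pred ('I_n * 'I_n.+1 * 'I_n.+1) :=
  fun x => let: (i, a, b) := x in
    [&& 1 <= i <= n.-1, 1 <= a, a < b & b <= i.+1].

Record asm_poset n :=
  AsmElt { asm_val : 'I_n * 'I_n.+1 * 'I_n.+1; _ : asm_elt asm_val }.

HB.instance Definition _ n := [isSub for @asm_val n].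
HB.instance Definition _ n := [Finite of asm_poset n by <:].

Section Coordinates.
Variable n : nat.
Implicit Types p q : asm_poset n.

Definition asm_layer p : nat := (val p).1.1.
Definition asm_a p : nat := (val p).1.2.
Definition asm_b p : nat := (val p).2.

Lemma asm_eltP p :
  [&& 1 <= asm_layer p <= n.-1, 1 <= asm_a p, asm_a p < asm_b p
    & asm_b p <= (asm_layer p).+1].
Proof. by case: p => [[[i a] b]]. Qed.

Lemma asm_inj p q :
  asm_layer p = asm_layer q -> asm_a p = asm_a q -> asm_b p = asm_b q -> p = q.
Proof.
case: p => [[[i a] b] Hp]; case: q => [[[i' a'] b'] Hq].
rewrite /asm_layer /asm_a /asm_b /= => Ei Ea Eb.
by apply: val_inj => /=; congr (_, _, _); apply: val_inj.
Qed.

Definition asm_covers p q : bool :=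
  [|| [&& 2 <= asm_b p - asm_a p, asm_layer q == asm_layer p,
          asm_a q == (asm_a p).+1 & asm_b q == asm_b p],
      [&& 2 <= asm_b p - asm_a p, asm_layer q == asm_layer p,
          asm_a q == asm_a p & asm_b q == (asm_b p).-1],
      [&& asm_layer q == (asm_layer p).+1,
          asm_a q == asm_a p & asm_b q == asm_b p]
    | [&& asm_layer q == (asm_layer p).+1,
          asm_a q == (asm_a p).+1 & asm_b q == (asm_b p).+1]].

Definition asm_le p q : bool := connect (fun x y => asm_covers y x) p q.

Definition asm_height p := asm_b p - asm_a p + (n - asm_layer p).

Lemma asm_covers_height p q : asm_covers p q -> asm_height p = (asm_height q).+1.
Proof.
have /and4P[/andP[p1 p2] p3 p4 p5] := asm_eltP p.
have /and4P[/andP[q1 q2] q3 q4 q5] := asm_eltP q.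
have n_gt0 : 0 < n by case: (n) p1 p2 => //; case: (asm_layer p).
rewrite /asm_height => /or4P[/and4P[d]|/and4P[d]|/and3P[]|/and3P[]].
- move=> /eqP-> /eqP Ea /eqP->; rewrite -addSn; congr (_ + _).
  by rewrite Ea subnS prednK // subn_gt0.
- move=> /eqP-> /eqP Ea /eqP Eb; rewrite -addSn; congr (_ + _).
  by rewrite Ea Eb -subn1 subnAC subn1 prednK // subn_gt0.
- move=> /eqP Ei /eqP-> /eqP->; rewrite -addnS; congr (_ + _).
  rewrite Ei subnS prednK // subn_gt0 -Ei.
  by rewrite (leq_trans _ (leq_pred n)) // -Ei.
- move=> /eqP Ei /eqP-> /eqP->; rewrite subSS -addnS; congr (_ + _).
  rewrite Ei subnS prednK // subn_gt0 -Ei.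
  by rewrite (leq_trans _ (leq_pred n)) // -Ei.
Qed.

Lemma asm_le_height p q : asm_le p q -> (p == q) || (asm_height p < asm_height q).
Proof.
case/connectP=> s; elim: s p => [|r s IHs] p /=; first by move=> _ ->; rewrite eqxx.
case/andP=> /asm_covers_height Hr /IHs{}IHs /IHs /orP[/eqP<-|lt_rq].
  by rewrite Hr ltnSn orbT.
by rewrite (ltn_trans _ lt_rq) ?orbT // Hr.
Qed.

Lemma asm_le_refl : reflexive asm_le.
Proof. exact: connect0. Qed.

Lemma asm_le_anti : antisymmetric asm_le.
Proof.
move=> p q /andP[/asm_le_height/orP[/eqP//|lt_pq]].
by case/asm_le_height/orP=> [/eqP//|/(ltn_trans lt_pq)]; rewrite ltnn.
Qed.

Lemma asm_le_trans : transitive asm_le.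
Proof. exact: connect_trans. Qed.

End Coordinates.

Fact asm_display : Order.disp_t. Proof. exact: (Order.Disp tt tt). Qed.

HB.instance Definition _ n :=
  Order.Le_isPOrder.Build asm_display (asm_poset n)
    (@asm_le_refl n) (@asm_le_anti n) (@asm_le_trans n).

Section Toggles.
Variable n : nat.
Implicit Types (p q : asm_poset n) (A : {set asm_poset n}).
Local Open Scope order_scope.

Definition order_ideal A : bool :=
  [forall p in A, forall q, (q <= p) ==> (q \in A)].

Record asm_ideal :=
  AsmIdeal { asm_ideal_val :> {set asm_poset n}; _ : order_ideal asm_ideal_val }.

HB.instance Definition _ := [isSub for asm_ideal_val].
HB.instance Definition _ := [Finite of asm_ideal by <:].

Lemma order_idealP A :
  reflect (forall p q, p \in A -> q <= p -> q \in A) (order_ideal A).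
Proof.
apply: (iffP forall_inP) => [HA p q pA | HA p pA].
  by move: (HA p pA) => /forallP/(_ q)/implyP.
by apply/forallP => q; apply/implyP; apply: HA.
Qed.

Definition toggle_set p A : {set asm_poset n} :=
  if (p \notin A) && [forall q, (q < p) ==> (q \in A)] then p |: A
  else if (p \in A) && [forall q, (p < q) ==> (q \notin A)] then A :\ p
  else A.

Lemma toggle_set_ideal p A : order_ideal A -> order_ideal (toggle_set p A).
Proof.
move=> /order_idealP HA; rewrite /toggle_set.
case: ifP => [/andP[_ /forallP Hlt]|_].
  apply/order_idealP => x y; rewrite !inE => /orP[/eqP->|xA] le_yx.
    by rewrite -[y == p]negbK; have:= implyP (Hlt y); rewrite lt_neqAle le_yx andbT;
       case: (y == p) => //= ->.
  by rewrite (HA x y xA le_yx) orbT.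
case: ifP => [/andP[_ /forallP Hgt]|_]; last exact/order_idealP.
apply/order_idealP => x y; rewrite !inE => /andP[neq_xp xA] le_yx.
rewrite (HA x y xA le_yx) andbT; apply: contraTneq xA => Ey.
by apply: (implyP (Hgt x)); rewrite lt_neqAle eq_sym neq_xp -Ey.
Qed.

Lemma toggle_setK p A : order_ideal A -> toggle_set p (toggle_set p A) = A.
Proof.
move=> /order_idealP HA; rewrite {2}/toggle_set.
case: ifP => [/andP[pA Hlt]|Nadd].
  rewrite /toggle_set !inE eqxx /= setU1K // ifT //.
  apply/forallP=> q; apply/implyP=> lt_pq; rewrite !inE negb_or gt_eqF //=.
  by apply: contra pA => qA; apply: HA qA (ltW lt_pq).
case: ifP => [/andP[pA Hgt]|Nrem]; last by rewrite /toggle_set Nadd Nrem.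
rewrite /toggle_set !inE eqxx /= ifT ?setD1K //.
apply/forallP=> q; apply/implyP=> lt_qp; rewrite !inE lt_eqF //=.
exact: HA pA (ltW lt_qp).
Qed.

Definition toggle_fun p (I : asm_ideal) : asm_ideal :=
  AsmIdeal (toggle_set_ideal p (valP I)).

Lemma toggle_funK p : involutive (toggle_fun p).
Proof. by move=> I; apply: val_inj; apply: toggle_setK (valP I). Qed.

Definition toggle p : {perm asm_ideal} := perm (can_inj (toggle_funK p)).

Lemma toggle_val p (I : asm_ideal) : toggle p I = toggle_set p I :> {set _}.
Proof. by rewrite permE. Qed.

Lemma toggleK p : (toggle p * toggle p = 1)%g.
Proof. by apply/permP=> I; rewrite permM perm1 !permE toggle_funK. Qed.

Definition no_cover p q := forall x y, (x = p /\ y = q) \/ (x = q /\ y = p) ->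
  x < y -> exists r, x < r < y.

Let addable p A := (p \notin A) && [forall q, (q < p) ==> (q \in A)].
Let removable p A := (p \in A) && [forall q, (p < q) ==> (q \notin A)].

Let add_rem_toggle p q A : order_ideal A -> p != q -> no_cover p q ->
  addable p (toggle_set q A) = addable p A /\
  removable p (toggle_set q A) = removable p A.
Proof.
move=> /order_idealP HA neq_pq NC; rewrite /toggle_set.
case: ifP => [/andP[qA /forallP Hlt]|_].
  rewrite /addable /removable !inE (negPf neq_pq) /=; split; congr (_ && _).
    apply/forallP/forallP=> H x; apply/implyP=> lt_xp.
      have := implyP (H x) lt_xp; rewrite !inE => /orP[/eqP Ex|//].
      have [r /andP[lt_qr lt_rp]] : exists r, q < r < p.
        by apply: NC; [right | rewrite -Ex].
      have := implyP (H r) lt_rp; rewrite !inE gt_eqF //= => rA.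
      by rewrite (HA r q rA (ltW lt_qr)) in qA.
    by rewrite !inE (implyP (H x) lt_xp) orbT.
  apply/forallP/forallP=> H x; apply/implyP=> lt_px.
    by have := implyP (H x) lt_px; rewrite !inE negb_or => /andP[].
  rewrite !inE negb_or (implyP (H x) lt_px) andbT; apply/eqP=> Ex.
  have [r /andP[lt_pr lt_rq]] : exists r, p < r < q.
    by apply: NC; [left | rewrite -Ex].
  by have := implyP (H r) lt_pr; rewrite (implyP (Hlt r) lt_rq).
case: ifP => [/andP[qA /forallP Hgt]|_] //.
rewrite /addable /removable !inE neq_pq /=; split; congr (_ && _).
  apply/forallP/forallP=> H x; apply/implyP=> lt_xp.
    by have := implyP (H x) lt_xp; rewrite !inE => /andP[].
  rewrite !inE (implyP (H x) lt_xp) andbT; apply/eqP=> Ex.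
  have [r /andP[lt_qr lt_rp]] : exists r, q < r < p.
    by apply: NC; [right | rewrite -Ex].
  by have := implyP (Hgt r) lt_qr; rewrite (implyP (H r) lt_rp).
apply/forallP/forallP=> H x; apply/implyP=> lt_px.
  have := implyP (H x) lt_px; rewrite !inE negb_and negbK => /orP[/eqP Ex|//].
  have [r /andP[lt_pr lt_rq]] : exists r, p < r < q.
    by apply: NC; [left | rewrite -Ex].
  by have := implyP (H r) lt_pr; rewrite !inE lt_eqF //= (HA q r qA (ltW lt_rq)).
by rewrite !inE negb_and (implyP (H x) lt_px) orbT.
Qed.

Lemma toggle_comm p q : no_cover p q -> commute (toggle p) (toggle q).
Proof.
move=> NC; have [->//|neq_pq] := eqVneq p q.
have NC' : no_cover q p by move=> x y [[-> ->]|[-> ->]]; apply: NC; [right|left].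
apply/permP=> I; rewrite !permM; apply: val_inj; rewrite /= !toggle_val.
have [ap rp] := add_rem_toggle (valP I) neq_pq NC.
have neq_qp : q != p by rewrite eq_sym.
have [aq rq] := add_rem_toggle (valP I) neq_qp NC'.
have E x A : toggle_set x A =
  if addable x A then x |: A else if removable x A then A :\ x else A by [].
rewrite [LHS]E [RHS]E aq rq ap rp !E.
apply/setP=> x; do 4?[case: ifP => _]; rewrite ?inE //;
  by case: (eqVneq x p) => [->|//]; rewrite ?(negPf neq_pq) ?orbT ?orbF ?andbF ?andbT.
Qed.

(* The inner product in pro is therefore independent of the order of its
   factors. *)
Lemma toggle_comm_diag p q : asm_layer p = asm_layer q ->
  (asm_a p + asm_b p = asm_a q + asm_b q)%N -> commute (toggle p) (toggle q).
Proof.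
move=> Elay Eab; apply: toggle_comm => x y Exy.
have [{}Elay {}Eab] : asm_layer x = asm_layer y /\
    (asm_a x + asm_b x = asm_a y + asm_b y)%N.
  by case: Exy => -[-> ->].
rewrite lt_neqAle => /andP[neq_xy /connectP[[|r s] /= Hs Ey]].
  by rewrite Ey eqxx in neq_xy.
case/andP: Hs => cov_rx Hs; exists r.
have le_xr : x <= r by apply: connect1.
have le_ry : r <= y by apply/connectP; exists s.
have neq_ry : r != y.
  apply: contraTneq cov_rx => ->; rewrite /asm_covers Elay eqxx.
  have /and4P[_ y1 y2 _] := asm_eltP y.
  rewrite (ltn_eqF (ltnSn (asm_layer y))) /= orbF; apply/negP=> /orP[]/and3P[_ /eqP Ea /eqP Eb]; move: Eab.
    by rewrite Ea Eb addSn => /esym/eqP; rewrite ltn_eqF.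
  have: (0 < asm_b y)%N by apply: leq_ltn_trans y2.
  by rewrite Ea Eb; case: (asm_b y) => // b _; rewrite addnS /= => /eqP; rewrite ltn_eqF.
have neq_xr : x != r.
  apply: contraTneq cov_rx => ->; apply/negP => /asm_covers_height/eqP.
  by rewrite (ltn_eqF (ltnSn _)).
by rewrite !lt_neqAle neq_xr neq_ry le_xr le_ry.
Qed.

End Toggles.

(* The product of permutations s * t applies s first. *)
Section Superpromotion.
Variable n : nat.
Local Open Scope group_scope.

Definition pro (i : nat) : {perm asm_ideal n} :=
  \prod_(3 <= t < (2 * i + 1).+1)
    \prod_(p : asm_poset n | (asm_layer p == i) && (asm_a p + asm_b p == t)%N)
      toggle p.

Definition spro : {perm asm_ideal n} := \prod_(i <- rev (index_iota 1 n)) pro i.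

End Superpromotion.

(* For n = 2 the poset has one element and spro is its toggle, an involution,
   whereas 3 * 2 - 2 = 4. *)
Lemma spro2_order : ~~ (3 * 2 - 2 %| #[spro 2]%g).
Proof.
have lay (p : asm_poset 2) : [/\ asm_layer p = 1, asm_a p = 1 & asm_b p = 2].
  move: (asm_eltP p); case: (asm_layer p) => [|[|i]] //=.
  by case: (asm_b p) => [|[|[|b]]]; case: (asm_a p) => [|[|a]]; rewrite /= ?andbF ?ltnS ?ltn0.
suff spro_sq : (spro 2 ^+ 2 = 1)%g.
  apply/negP=> dvd4; have: #[spro 2]%g %| 2 by rewrite order_dvdn spro_sq.
  by move/(dvdn_trans dvd4).
have -> : spro 2 = pro 2 1 by rewrite /spro /index_iota /= big_seq1.
rewrite /pro big_nat1; case: (pickP (@predT (asm_poset 2))) => [p0 _|no].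
  rewrite (big_pred1 p0) ?expgS ?expg0 ?mulg1 ?toggleK // => p; have [-> -> ->] := lay p.
  have [l0 a0 b0] := lay p0; have [l1 a1 b1] := lay p.
  by symmetry; apply/eqP; apply: asm_inj; rewrite ?l0 ?a0 ?b0.
by rewrite big1 ?expg1n // => p; have := no p.
Qed.

(* Main.v *)
Require Import Defs.
From mathcomp Require Import all_boot all_order all_fingroup.
From mathcomp Require Import zify.

Set Implicit Arguments.
Unset Strict Implicit.
Unset Printing Implicit Defensive.

Import Order.TTheory.

(** The orbit of the empty ideal under superpromotion has exactly [3n-2]
    elements.  Its [k]-th member can be written down explicitly ([orbit_mem]):
    layer by layer it fills up by height for [k <= i], then empties from large
    [b] while refilling from large [a] for [i <= k < 2n], and finally empties
    again by height.  When an element is toggled during one application of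
    superpromotion, exactly the neighbours in deeper layers and those with
    smaller [a + b] have been updated, so that one step of the orbit reduces to
    a local identity of linear arithmetic.  For [n > 2] the [k]-th member is
    nonempty whenever [0 < k < 3n-2]. *)

(** * Covers and toggles in coordinates *)

Section Elements.
Variable n : nat.
Implicit Types p q : asm_poset n.

Lemma asm_eltE i a b : 1 <= i < n -> 1 <= a < b -> b <= i.+1 ->
  exists p : asm_poset n, [/\ asm_layer p = i, asm_a p = a & asm_b p = b].
Proof.
move=> Hi Ha Hb.
have lt_i : i < n by lia.
have lt_a : a < n.+1 by lia.
have lt_b : b < n.+1 by lia.
have H : asm_elt (Ordinal lt_i, Ordinal lt_a, Ordinal lt_b).
  by rewrite /asm_elt /=; lia.
by exists (AsmElt H).
Qed.

Lemma asm_covers_lt p q : asm_covers p q -> (q < p)%O.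
Proof.
move=> pq; rewrite lt_neqAle; apply/andP; split; last exact: connect1.
by apply: contraTneq pq => ->; apply/negP=> /asm_covers_height; lia.
Qed.

Lemma asm_lt_coverl p q : (q < p)%O -> exists2 r, asm_covers p r & (q <= r)%O.
Proof.
rewrite lt_neqAle => /andP[neq_qp /connectP[s]].
elim/last_ind: s => [|s r _]; first by move=> _ E; rewrite E eqxx in neq_qp.
rewrite rcons_path last_rcons => /andP[qs cov] Er; rewrite Er.
by exists (last q s) => //; apply/connectP; exists s.
Qed.

Lemma asm_lt_coverr p q : (p < q)%O -> exists2 r, asm_covers r p & (r <= q)%O.
Proof.
rewrite lt_neqAle => /andP[neq_pq /connectP[[|r s] /=]].
  by move=> _ E; rewrite E eqxx in neq_pq.
by case/andP=> cov rs Eq; exists r => //; apply/connectP; exists s.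
Qed.

(** Since [J] is closed downward, testing everything strictly below or above [p] reduces to testing
    its covers, so toggling is a local rule. *)
Lemma toggle_mem p q (J : asm_ideal n) :
  (q \in (toggle p J : {set _})) =
    if q == p then
      if p \in (J : {set _}) then
        [exists r, asm_covers r p && (r \in (J : {set _}))]
      else [forall r, asm_covers p r ==> (r \in (J : {set _}))]
    else q \in (J : {set _}).
Proof.
have /order_idealP HJ := valP J.
rewrite toggle_val /toggle_set.
have -> : [forall r, (r < p)%O ==> (r \in (J : {set _}))] =
          [forall r, asm_covers p r ==> (r \in (J : {set _}))].
  apply/forallP/forallP=> H r; apply/implyP.
    by move=> /asm_covers_lt; apply: implyP (H r).
  case/asm_lt_coverl=> x /(implyP (H x)) xJ; exact: HJ.
have -> : [forall r, (p < r)%O ==> (r \notin (J : {set _}))] =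
          ~~ [exists r, asm_covers r p && (r \in (J : {set _}))].
  rewrite negb_exists; apply/forallP/forallP=> H r.
    rewrite negb_and -implybE; apply/implyP=> /asm_covers_lt; exact: implyP (H r).
  apply/implyP=> /asm_lt_coverr[x cov le_xr]; apply/negP=> rJ.
  by move: (H x); rewrite cov (HJ _ _ rJ le_xr).
case: (boolP (p \in (J : {set _}))) => pJ /=.
  by case: ifP => [/negPf|/negbFE] ->; rewrite ?inE; case: eqVneq => [->|].
by case: ifP => _; rewrite ?inE; case: eqVneq => [->|] //=; rewrite (negPf pJ).
Qed.

(** Each guard says exactly when the neighbour exists. Because $a<b$ and $b\le i+1$, either of $1<a$
    and $b\le i$ forces $i\ge 2$, so layer $i-1$ needs no guard of its own. *)
Lemma exists_cover_above (G : nat -> nat -> nat -> bool) p :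
  [exists r, asm_covers r p && G (asm_layer r) (asm_a r) (asm_b r)] =
  let: (i, a, b) := (asm_layer p, asm_a p, asm_b p) in
  [|| (1 < a) && G i a.-1 b, (b <= i) && G i a b.+1,
      (b <= i) && G i.-1 a b | (1 < a) && G i.-1 a.-1 b.-1].
Proof.
have Hp := asm_eltP p.
apply/existsP/idP => [[r /andP[]]|].
  have := asm_eltP r; rewrite /asm_covers.
  move: (asm_layer r) (asm_a r) (asm_b r) => i a b Hr.
  case/or4P=> [/and4P[? /eqP El /eqP Ea /eqP Eb]|/and4P[? /eqP El /eqP Ea /eqP Eb]
    |/and3P[/eqP El /eqP Ea /eqP Eb]|/and3P[/eqP El /eqP Ea /eqP Eb]] Gr.
  - by apply/or4P/Or41; rewrite El Ea Eb /= Gr andbT; lia.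
  - apply/or4P/Or42; rewrite El Ea Eb prednK; last by lia.
    by rewrite Gr andbT; lia.
  - by apply/or4P/Or43; rewrite El Ea Eb /= Gr andbT; lia.
  - by apply/or4P/Or44; rewrite El Ea Eb /= Gr andbT; lia.
case/or4P=> /andP[H Gr].
- have [||//|r [El Ea Eb]] := @asm_eltE (asm_layer p) (asm_a p).-1 (asm_b p);
    [lia..|exists r].
  by rewrite /asm_covers El Ea Eb Gr andbT; lia.
- have [||//|r [El Ea Eb]] := @asm_eltE (asm_layer p) (asm_a p) (asm_b p).+1;
    [lia..|exists r].
  by rewrite /asm_covers El Ea Eb Gr andbT; lia.
- have [|||r [El Ea Eb]] := @asm_eltE (asm_layer p).-1 (asm_a p) (asm_b p);
    [lia..|exists r].
  by rewrite /asm_covers El Ea Eb Gr andbT; lia.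
- have [|||r [El Ea Eb]] := @asm_eltE (asm_layer p).-1 (asm_a p).-1 (asm_b p).-1;
    [lia..|exists r].
  by rewrite /asm_covers El Ea Eb Gr andbT; lia.
Qed.

Lemma forall_cover_below (G : nat -> nat -> nat -> bool) p :
  [forall r, asm_covers p r ==> G (asm_layer r) (asm_a r) (asm_b r)] =
  let: (i, a, b) := (asm_layer p, asm_a p, asm_b p) in
  ((a.+1 < b) ==> G i a.+1 b && G i a b.-1) &&
  ((i.+1 < n) ==> G i.+1 a b && G i.+1 a.+1 b.+1).
Proof.
have Hp := asm_eltP p.
apply/forallP/idP => [H|/andP[/implyP H1 /implyP H2] r].
  have H' i a b : 1 <= i < n -> 1 <= a < b -> b <= i.+1 ->
      (forall r, asm_layer r = i -> asm_a r = a -> asm_b r = b ->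
       asm_covers p r) -> G i a b.
    move=> h1 h2 h3 cov; have [r [El Ea Eb]] := asm_eltE h1 h2 h3.
    by have := implyP (H r) (cov r El Ea Eb); rewrite El Ea Eb.
  apply/andP; split; apply/implyP=> lt; apply/andP; split;
    (apply: H'; [lia..|rewrite /asm_covers => r -> -> ->; lia]).
apply/implyP; have := asm_eltP r; rewrite /asm_covers => Hr.
case/or4P=> [/and4P[? /eqP El /eqP Ea /eqP Eb]|/and4P[? /eqP El /eqP Ea /eqP Eb]
  |/and3P[/eqP El /eqP Ea /eqP Eb]|/and3P[/eqP El /eqP Ea /eqP Eb]].
- by rewrite El Ea Eb; have /andP[] : _ := H1 ltac:(lia).
- by rewrite El Ea Eb; have /andP[] : _ := H1 ltac:(lia).
- by rewrite El Ea Eb; have /andP[] : _ := H2 ltac:(lia).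
- by rewrite El Ea Eb; have /andP[] : _ := H2 ltac:(lia).
Qed.

End Elements.

(** * The explicit orbit and its local recurrence *)

(* Membership of [(i;a,b)] in the [k]-th iterate of the empty ideal. *)
Definition orbit_mem (n k i a b : nat) : bool :=
  if k <= i then b <= a + k
  else if k < 2 * n then (2 * n <= a + k) || (b + k <= 2 * i + 1)
  else b + k < a + i + 2 * n.

(** This is the toggle rule at $(i;a,b)$: neighbours with index [k.+1] (layer $i+1$, or layer $i$
    with smaller $a+b$) are toggled earlier, those with index [k] later. *)
Lemma orbit_mem_step n k i a b :
  1 <= i < n -> 1 <= a < b -> b <= i.+1 -> k < 3 * n - 2 ->
  orbit_mem n k.+1 i a b =
  if orbit_mem n k i a b then
    [|| (1 < a) && orbit_mem n k.+1 i a.-1 b, (b <= i) && orbit_mem n k i a b.+1,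
        (b <= i) && orbit_mem n k i.-1 a b
      | (1 < a) && orbit_mem n k i.-1 a.-1 b.-1]
  else
    ((a.+1 < b) ==> orbit_mem n k i a.+1 b && orbit_mem n k.+1 i a b.-1) &&
    ((i.+1 < n) ==> orbit_mem n k.+1 i.+1 a b && orbit_mem n k.+1 i.+1 a.+1 b.+1).
Proof.
move=> Hi Ha Hb Hk; rewrite /orbit_mem.
have [lt_ki|ge_ki] := ltnP k i.
  have -> : k <= i by lia.
  have -> : k <= i.-1 by lia.
  have -> : k < i.+1 by lia.
  by case: ifP; lia.
(* At $k=i$ all regimes meet: layer $i-1$ has left its filling phase, layer $i$ leaves it in this
   step, and layer $i+1$ is still filling at time $k+1$. *)
have [eq_ki|neq_ki] := eqVneq k i.
  have -> : k <= i by lia.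
  have -> : (k <= i.-1) = false by lia.
  have -> : k < i.+1 by lia.
  have -> : k < 2 * n by lia.
  have -> : k.+1 < 2 * n by lia.
  by case: ifP; lia.
have -> : (k <= i) = false by lia.
have -> : (k <= i.-1) = false by lia.
have -> : (k < i.+1) = false by lia.
have [lt_k|ge_k] := ltnP k.+1 (2 * n).
  have -> : k < 2 * n by lia.
  by case: ifP; lia.
have [lt_k|ge_k'] := ltnP k (2 * n); by case: ifP; lia.
Qed.

(** * One application of superpromotion, toggle by toggle *)

Section OneStep.
Variables n k : nat.
Hypothesis k_lt : k < 3 * n - 2.
Implicit Types (p q r : asm_poset n) (J : asm_ideal n) (D : pred (asm_poset n)).

Definition orbit_at m q := orbit_mem n m (asm_layer q) (asm_a q) (asm_b q).

(* The elements toggled before those with layer [i] and [a + b = t]. *)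
Definition done i t q :=
  (i < asm_layer q) || (asm_layer q == i) && (asm_a q + asm_b q < t).

(* [J] agrees with the [k.+1]-st orbit member on [D] and with the [k]-th one
   elsewhere. *)
Definition updated D J :=
  forall q, (q \in (J : {set _})) = orbit_at (k + D q) q.

Lemma eq_updated D D' J : D =1 D' -> updated D J -> updated D' J.
Proof. by move=> eqD HJ q; rewrite HJ eqD. Qed.

(** [D] is compared with [done] only at neighbours of [p], so the lemma also applies midway through
    a diagonal. *)
Lemma updated_toggle D J p :
  updated D J -> D p = false ->
  (forall r, asm_covers p r || asm_covers r p ->
     D r = done (asm_layer p) (asm_a p + asm_b p) r) ->
  updated [pred q | D q || (q == p)] (toggle p J).
Proof.
move=> HJ Dp HD q; rewrite toggle_mem /=.
case: eqVneq => [->|_]; last by rewrite orbF HJ.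
rewrite orbT addn1 HJ Dp addn0.
pose G i a b := orbit_mem n
  (k + ((asm_layer p < i) || (i == asm_layer p) && (a + b < asm_a p + asm_b p)))
  i a b.
have -> : [exists r, asm_covers r p && (r \in (J : {set _}))] =
          [exists r, asm_covers r p && G (asm_layer r) (asm_a r) (asm_b r)].
  apply: eq_existsb => r; case: (boolP (asm_covers r p)) => //= cov.
  by rewrite HJ HD ?cov ?orbT.
have -> : [forall r, asm_covers p r ==> (r \in (J : {set _}))] =
          [forall r, asm_covers p r ==> G (asm_layer r) (asm_a r) (asm_b r)].
  apply: eq_forallb => r; case: (boolP (asm_covers p r)) => //= cov.
  by rewrite HJ HD ?cov.
have := asm_eltP p; rewrite exists_cover_above forall_cover_below /orbit_at /G.
move: (asm_layer p) (asm_a p) (asm_b p) => i a b /= Hp.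
rewrite orbit_mem_step //; try by lia.
have -> : (i < i) || (i == i) && (a.-1 + b < a + b) = true by lia.
have -> : (i < i) || (i == i) && (a + b.+1 < a + b) = false by lia.
have -> : (i < i.-1) || (i.-1 == i) && (a + b < a + b) = false by lia.
have -> : (i < i.-1) || (i.-1 == i) && (a.-1 + b.-1 < a + b) = false by lia.
have -> : (i < i) || (i == i) && (a.+1 + b < a + b) = false by lia.
have -> : (i < i) || (i == i) && (a + b.-1 < a + b) = true by lia.
by rewrite !ltnSn addn0 addn1.
Qed.

Lemma updated_diagonal i t J : updated (done i t) J ->
  updated (done i t.+1)
    ((\prod_(p : asm_poset n | (asm_layer p == i) && (asm_a p + asm_b p == t)%N)
        toggle p)%g J).
Proof.
pose P p := (asm_layer p == i) && (asm_a p + asm_b p == t).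
(* A cover changes either the layer or, within a layer, $a+b$ by one, so no two elements of a
   diagonal are neighbours. *)
have nP p r : P p -> asm_covers p r || asm_covers r p -> ~~ P r.
  have := asm_eltP p; have := asm_eltP r.
  by rewrite /P /asm_covers => Hr Hp; lia.
(* For the induction on [s], [D] is free on the diagonal, where it records the toggles already
   made. *)
suff H (s : seq (asm_poset n)) D J' : uniq s ->
    {in s, forall p, P p -> D p = false} ->
    (forall r, ~~ P r -> D r = done i t r) -> updated D J' ->
    updated [pred q | D q || P q && (q \in s)] ((\prod_(p <- s | P p) toggle p)%g J').
  move=> HJ; have := H _ _ _ (index_enum_uniq _) _ _ HJ.
  move=> {}H; apply: eq_updated (H _ _) => //.
    by move=> q /=; rewrite mem_index_enum andbT /done /P; lia.
  by move=> p _; rewrite /P /done; lia.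
elim: s D J' => [|p s IHs] D J'.
  move=> _ _ _ HJ'; rewrite big_nil perm1; apply: eq_updated HJ' => q /=.
  by rewrite in_nil andbF orbF.
rewrite cons_uniq => /andP[p_s uniq_s] Ds DP HJ'; rewrite big_cons.
case: ifPn => [Pp|nPp]; last first.
  apply: eq_updated (IHs D J' uniq_s _ DP HJ').
    by move=> q /=; rewrite inE; case: eqVneq => [->|//]; rewrite (negPf nPp).
  by move=> q qs; apply: Ds; rewrite inE qs orbT.
have Dp : D p = false by apply: Ds; rewrite ?mem_head.
rewrite permM; apply: eq_updated (IHs [pred q | D q || (q == p)] _ uniq_s _ _ _).
- by move=> q /=; rewrite inE; case: eqVneq => [->|]; rewrite ?Pp ?orbT ?orbF.
- move=> q qs Pq /=; rewrite Ds ?inE ?qs ?orbT //=.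
  by apply: contraNF p_s => /eqP <-.
- by move=> r nPr /=; rewrite DP //; case: eqVneq nPr => [->|]; rewrite ?Pp ?orbF.
- apply: updated_toggle => // r cov; rewrite DP ?(nP p) //.
  by move: Pp => /andP[/eqP-> /eqP->].
Qed.

Lemma updated_pro i J : updated [pred q | i < asm_layer q] J ->
  updated [pred q | i <= asm_layer q] (pro n i J).
Proof.
move=> HJ.
have H m : updated (done i (3 + m))
    ((\prod_(3 <= t < 3 + m)
      \prod_(p : asm_poset n | (asm_layer p == i) && (asm_a p + asm_b p == t)%N)
        toggle p)%g J).
  elim: m => [|m IHm].
    rewrite addn0 big_geq // perm1; apply: eq_updated HJ => q.
    by have := asm_eltP q; rewrite /done /=; lia.
  rewrite addnS big_nat_recr ?leq_addr //= permM.
  exact: updated_diagonal.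
(* For $i=0$ the product is empty, and the truncated [(2 * i).-1] below would give the wrong
   bound. *)
case: (posnP i) => [i0|i_gt0].
  rewrite /pro big_geq ?i0 // perm1; apply: eq_updated HJ => q.
  by have := asm_eltP q; rewrite i0 /=; lia.
rewrite /pro; have -> : (2 * i + 1).+1 = 3 + (2 * i).-1 by lia.
apply: eq_updated (H _) => q.
by have := asm_eltP q; rewrite /done /=; lia.
Qed.

Lemma spro_orbit J :
  (forall q, (q \in (J : {set _})) = orbit_at k q) ->
  forall q, (q \in (spro n J : {set _})) = orbit_at k.+1 q.
Proof.
move=> HJ.
(* Here [m] counts the layers still to be promoted, the deepest first; at $m=n-1$ nothing has been
   updated yet. *)
suff H m J' : updated [pred q | m < asm_layer q] J' ->
    updated predT ((\prod_(i <- rev (index_iota 1 m.+1)) pro n i)%g J').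
  have n_gt0 : 0 < n by lia.
  have := H n.-1 J; rewrite prednK // => {}H q.
  rewrite (H _ q) ?addn1 // => r; rewrite HJ /=.
  have := asm_eltP r => Hr.
  have -> : (n <= asm_layer r) = false by lia.
  by rewrite addn0.
elim: m J' => [|m IHm] J' HJ'.
  rewrite big_nil perm1; apply: eq_updated HJ' => q.
  by have := asm_eltP q => /= ?; lia.
have -> : rev (index_iota 1 m.+2) = m.+1 :: rev (index_iota 1 m.+1).
  by rewrite /index_iota !subSS !subn0 -[m.+1 in LHS]addn1 iotaD rev_cat add1n.
by rewrite big_cons permM; apply: IHm; apply: updated_pro.
Qed.

End OneStep.

(** * The orbit of the empty ideal and its length *)

Lemma set0_ideal n : order_ideal (set0 : {set asm_poset n}).
Proof. by apply/order_idealP => p q; rewrite inE. Qed.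

Lemma spro_iter_set0 n k q : k <= 3 * n - 2 ->
  (q \in ((spro n ^+ k)%g (AsmIdeal (set0_ideal n)) : {set _})) = orbit_at k q.
Proof.
elim: k q => [|k IHk] q lt_k.
  rewrite expg0 perm1 inE /orbit_at /orbit_mem.
  by have := asm_eltP q; rewrite leq0n; lia.
rewrite expgSr permM; apply: spro_orbit => // r.
exact: IHk (ltnW lt_k).
Qed.

Lemma orbit_mem_inhabited n k : 2 < n -> 0 < k < 3 * n - 2 ->
  exists q : asm_poset n, orbit_at k q.
Proof.
(* In layer $n-1$, $(a,b)=(1,2)$ belongs to every such member except the one with $k=2n-2$, where
   $(2,3)$ does; the latter exists because $n>2$. *)
move=> n_gt2 Hk; pose c := (k == 2 * n - 2) : nat.
have [|||q [El Ea Eb]] := @asm_eltE n n.-1 c.+1 c.+2; try by rewrite /c; lia.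
by exists q; rewrite /orbit_at /orbit_mem El Ea Eb /c; do ?case: ifP; lia.
Qed.

Theorem theorem8p15 (n : nat) (n_gt0 : 1 <= n) (n_neq2 : n <> 2) :
  3 * n - 2 %| #[spro n]%g.
Proof.
have [-> //|n_neq1] := eqVneq n 1.
have n_gt2 : 2 < n by lia.
pose E := AsmIdeal (set0_ideal n); set d := 3 * n - 2.
(* At $k=3n-2$ membership would require $b-a+n-2<i$, impossible as $b-a\ge 1$ and $i\le n-1$. *)
have spro_d : (spro n ^+ d)%g E = E.
  apply/val_inj/setP=> q; rewrite spro_iter_set0 // inE.
  rewrite /orbit_at /orbit_mem /d.
  by have := asm_eltP q; do ?case: ifP; lia.
set m := #[spro n]%g.
(* The powers $m$ and $d$ both fix [E], hence so does the remainder; a nonzero one would make a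
   nonempty orbit member equal to [E]. *)
have spro_r : (spro n ^+ (m %% d))%g E = E.
  have : (spro n ^+ m)%g E = E by rewrite expg_order perm1.
  by rewrite {1}(divn_eq m d) expgD permM mulnC expgM (permX _ _ (m %/ d)) iter_fix.
have lt_r : m %% d < d by rewrite ltn_mod /d; lia.
rewrite /dvdn; have [//|r_gt0] := posnP (m %% d).
have [|q] := @orbit_mem_inhabited n (m %% d) n_gt2; first by rewrite r_gt0.
by rewrite -spro_iter_set0 ?(ltnW lt_r) // spro_r inE.
Qed.
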